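(* Let $\mathcal F$ be a finite $\cup$-closed family of finite sets with base $\mathcal B$. Then $\mathcal F$ is well-graded if and only if, for any two distinct sets $K$ and $L$ in $\mathcal B$, there is a tight path in $\mathcal F$ from $K$ to $L\cup K$. Moreover, if $\mathcal B$ contains the empty set, then $\mathcal F$ is well-graded if and only if there is a tight path in $\mathcal F$ from $\varnothing$ to $K$ for every $K\in\mathcal B$.
   Context: All sets and families are finite. For finite sets $P,Q$ let $d(P,Q)=|P\bigtriangleup Q|$. A tight path in a family $\mathcal F$ from $P$ to $Q$ (both in $\mathcal F$, $P\ne Q$) is a sequence $P_0=P,P_1,\ldots,P_n=Q$ of members of $\mathcal F$ with $d(P,Q)=n$ and $d(P_i,P_{i+1})=1$ for $0\le i\le n-1$; if $P=Q$, the one-term sequence $P_0=P$ counts as a (trivial) tight path. The family $\mathcal F$ is well-graded if there is a tight path in $\mathcal F$ between any two of its distinct sets. $\mathcal F$ is $\cup$-closed if $\cup\mathcal G\in\mathcal F$ for every nonempty $\mathcal G\subseteq\mathcal F$. The span of a family $\mathcal G$ is the family of all unions of nonempty subfamilies of $\mathcal G$ (so $\varnothing$ is in the span only if $\varnothing\in\mathcal G$). A base of a $\cup$-closed family $\mathcal F$ is a subfamily of $\mathcal F$ whose span is $\mathcal F$ and which is minimal under inclusion with this property; every finite $\cup$-closed family has a unique base. *)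

(* Defs.v *)
From mathcomp Require Import all_boot.
From mathcomp Require Import finmap.

Set Implicit Arguments.
Unset Strict Implicit.
Unset Printing Implicit Defensive.

Local Open Scope fset_scope.

Definition sdist (T : choiceType) (P Q : {fset T}) : nat :=
  #|` (P `\` Q) `|` (Q `\` P)|.

(* P :: s is the whole sequence P_0 = P, ..., P_n = Q, so n = size s; for
   P = Q the only such s is the empty one, i.e. the trivial path. *)
Definition tight_path (T : choiceType) (F : {fset {fset T}}) (P Q : {fset T})
    (s : seq {fset T}) : Prop :=
  [/\ {subset P :: s <= F}, last P s = Q, size s = sdist P Q
    & path (fun A B => sdist A B == 1%N) P s].

Definition well_graded (T : choiceType) (F : {fset {fset T}}) : Prop :=
  forall P Q, P \in F -> Q \in F -> P != Q -> exists s, tight_path F P Q s.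

Definition union_closed (T : choiceType) (F : {fset {fset T}}) : Prop :=
  forall G : {fset {fset T}}, G `<=` F -> G != fset0 -> fcover G \in F.

Definition family_span (T : choiceType) (G : {fset {fset T}}) :
    {fset {fset T}} :=
  [fset fcover H | H in fpowerset G & H != fset0].

Definition is_base (T : choiceType) (F B : {fset {fset T}}) : Prop :=
  [/\ B `<=` F, family_span B = F
    & forall B' : {fset {fset T}}, B' `<=` B -> family_span B' = F -> B' = B].

(* Main.v *)
(* Call a chain of members of F a climb when each set arises from the previous
   one by adding an element, possibly one already present.  Allowing such idle
   steps makes climbs stable under union with a fixed member of F, so climbs
   between base sets can be transported and composed to give a climb from any P
   in F to P union Q.  Going up from P to P union Q and then down to Q, with the
   idle steps discarded, is a tight path. *)
Require Import Defs.
From mathcomp Require Import all_boot.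
From mathcomp Require Import finmap.

Local Open Scope fset_scope.

Section Climb.
Context {T : choiceType}.
Implicit Types (P Q R : {fset T}) (F B : {fset {fset T}}).

Inductive climb F P : {fset T} -> Prop :=
| climb_refl : P \in F -> climb F P P
| climb_step Q x : climb F P Q -> x |` Q \in F -> climb F P (x |` Q).

Lemma climb_in F P Q : climb F P Q -> P \in F /\ Q \in F.
Proof. by elim=> [|{}Q x _ []]. Qed.

Lemma climb_sub F P Q : climb F P Q -> P `<=` Q.
Proof.
by elim=> // {}Q x _ PQ _; exact: fsubset_trans PQ (fsubsetUr _ _).
Qed.

Lemma climb_trans F P Q R : climb F P Q -> climb F Q R -> climb F P R.
Proof. by move=> PQ; elim=> // {}R x _ PR; exact: climb_step. Qed.

Lemma union_closedU F P Q :
  union_closed F -> P \in F -> Q \in F -> P `|` Q \in F.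
Proof.
move=> UF PF QF.
have -> : P `|` Q = fcover [fset P; Q].
  apply/fsetP => x; rewrite in_fsetU; apply/idP/bigfcupP => [/orP[]xP|].
  - by exists P; rewrite // !inE eqxx.
  - by exists Q; rewrite // !inE eqxx orbT.
  by case=> A; rewrite !inE andbT => /orP[]/eqP-> ->; rewrite ?orbT.
apply: UF; first by apply/fsubsetP => A; rewrite !inE => /orP[]/eqP->.
by apply/fset0Pn; exists P; rewrite !inE eqxx.
Qed.

Lemma climbU F P Q R : union_closed F -> R \in F ->
  climb F P Q -> climb F (P `|` R) (Q `|` R).
Proof.
move=> UF RF; elim=> [PF|{}Q x _ IH xQF].
  by apply: climb_refl; exact: union_closedU.
by rewrite -fsetUA; apply: climb_step => //; rewrite fsetUA; exact: union_closedU.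
Qed.

Lemma sdistC P Q : sdist P Q = sdist Q P.
Proof. by rewrite /sdist fsetUC. Qed.

Lemma sdist_sub P Q : P `<=` Q -> sdist P Q = #|` Q `\` P|.
Proof. by rewrite /sdist -fsetD_eq0 => /eqP->; rewrite fset0U. Qed.

Lemma sdist_eq0 P Q : (sdist P Q == 0) = (P == Q).
Proof.
by rewrite /sdist cardfs_eq0 fsetU_eq0 !fsetD_eq0 eqEfsubset.
Qed.

(** The symmetric difference is a singleton: membership flips at its element [x] and agrees
    everywhere else, so the direction depends only on whether [x] is in [P]. *)
Lemma sdist_eq1 P Q :
  sdist P Q = 1 -> exists x, Q = x |` P \/ P = x |` Q.
Proof.
move/eqP/cardfs1P=> [x /fsetP E]; exists x.
have xPQ : (x \in Q) = (x \notin P).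
  by move: (E x); rewrite !inE eqxx; case: (x \in P); case: (x \in Q).
have yPQ y : y != x -> (y \in Q) = (y \in P).
  move=> /negPf yx; move: (E y); rewrite !inE yx.
  by case: (y \in P); case: (y \in Q).
case xP: (x \in P); [right | left]; apply/fsetP => y; rewrite !inE;
  by have [->|/yPQ->] := eqVneq y x; rewrite ?xPQ ?xP.
Qed.

Lemma sdist_add P Q x : x \notin P -> x \notin Q ->
  sdist P (x |` Q) = (sdist P Q).+1.
Proof.
move=> xP xQ; rewrite /sdist.
have -> : (P `\` (x |` Q)) `|` ((x |` Q) `\` P) =
          x |` ((P `\` Q) `|` (Q `\` P)).
  apply/fsetP => y; rewrite !inE.
  by have [->|_] := eqVneq y x; rewrite ?xP //= ?orbT.
by rewrite cardfsU1 !inE (negPf xP) (negPf xQ).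
Qed.

Lemma sdist_remove P Q x : x \in P -> x \notin Q ->
  sdist P Q = (sdist P (x |` Q)).+1.
Proof.
move=> xP xQ; rewrite /sdist.
have -> : (P `\` Q) `|` (Q `\` P) =
          x |` ((P `\` (x |` Q)) `|` ((x |` Q) `\` P)).
  apply/fsetP => y; rewrite !inE.
  by have [->|_] := eqVneq y x; rewrite ?xP ?(negPf xQ).
by rewrite cardfsU1 !inE eqxx xP.
Qed.

Lemma sdist_fsetU1 Q x : x \notin Q -> sdist Q (x |` Q) = 1.
Proof.
by move=> xQ; rewrite sdist_add //; congr _.+1; apply/eqP; rewrite sdist_eq0.
Qed.

Lemma tight_path_refl F P : P \in F -> tight_path F P P [::].
Proof.
move=> PF; split=> //; first by move=> A; rewrite inE => /eqP->.
by apply/esym/eqP; rewrite sdist_eq0.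
Qed.

Lemma tight_path_rcons F P Q R s : tight_path F P Q s -> R \in F ->
  sdist Q R = 1 -> sdist P R = (sdist P Q).+1 ->
  tight_path F P R (rcons s R).
Proof.
move=> [sF lastQ szs es] RF QR PR; split.
- move=> A; rewrite -rcons_cons mem_rcons inE => /orP[/eqP->//|]; exact: sF.
- by rewrite last_rcons.
- by rewrite size_rcons szs PR.
- by rewrite rcons_path es lastQ QR.
Qed.

(** Idle steps are skipped. A genuine step adds an element outside the current set, hence outside
    [P], so the distance from [P] grows by one. *)
Lemma tight_path_up F P Q : climb F P Q -> exists s, tight_path F P Q s.
Proof.
elim=> [/tight_path_refl|{}Q x PQ [s sPQ] xQF]; first by exists [::].
have [xQ|xQ] := boolP (x \in Q).
  by exists s; rewrite (mem_fset1U xQ).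
exists (rcons s (x |` Q)); apply: tight_path_rcons (sPQ) _ _ _ => //.
  exact: sdist_fsetU1.
by apply: sdist_add => //; apply: contra xQ; exact/fsubsetP/(climb_sub _ _ _ PQ).
Qed.

(** The climb is walked backwards from [R], last step first, each removal being appended to the
    tight path already built from [P]. The bound on [R] keeps the walk tight. *)
Lemma tight_path_down F P Q R : climb F Q R -> R `<=` P `|` Q ->
  (exists s, tight_path F P R s) -> exists s, tight_path F P Q s.
Proof.
elim=> // {}R x QR IH xRF; rewrite fsubUset fsub1set => /andP[xPQ RPQ] [s sPR].
have [xR|xR] := boolP (x \in R).
  by apply: IH => //; exists s; rewrite -(mem_fset1U xR).
have [_ RF] := climb_in _ _ _ QR.
(* The current set contains [Q] but not [x], so the bound leaves only [P] to contain [x]. *)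
have xP : x \in P.
  move: xPQ; rewrite inE => /orP[//|xQ].
  by case/negP: xR; exact: (fsubsetP (climb_sub _ _ _ QR)).
apply: IH => //; exists (rcons s R); apply: tight_path_rcons sPR _ _ _ => //.
  by rewrite sdistC; exact: sdist_fsetU1.
exact: sdist_remove.
Qed.

Lemma card_step P Q : sdist P Q = 1 -> (#|` Q| <= #|` P|.+1)%N.
Proof.
case/sdist_eq1=> x [] ->; first by rewrite cardfsU1; case: (_ \notin _).
exact/leqW/fsubset_leq_card/fsubsetUr.
Qed.

Lemma card_last_path P s : path (fun A C => sdist A C == 1) P s ->
  (#|` last P s| <= #|` P| + size s)%N.
Proof.
elim: s P => [|Q s IH] P /=; first by rewrite addn0.
move=> /andP[/eqP/card_step PQ /IH Qs].
by rewrite addnS -addSn (leq_trans Qs) // leq_add2r.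
Qed.

(* Each step changes the cardinality by at most one, so a path as long as the
   increase of cardinality only adds elements. *)
Lemma path_climb F P s : {subset P :: s <= F} ->
  path (fun A C => sdist A C == 1) P s ->
  #|` last P s| = (#|` P| + size s)%N -> climb F P (last P s).
Proof.
elim: s P => [|Q s IH] P /= sF.
  by move=> _ _; apply/climb_refl/sF/mem_head.
move=> /andP[/eqP PQ Qs] cardE.
have PF : P \in F by apply/sF/mem_head.
have sF' : {subset Q :: s <= F} by move=> A As; apply: sF; rewrite inE As orbT.
have QF : Q \in F by apply/sF'/mem_head.
have cardQ : #|` Q| = #|` P|.+1.
  (* If [Q] were no larger than [P], the remaining [size s] steps could not reach the required
     cardinality. *)
  apply/eqP; rewrite eqn_leq card_step //= -(leq_add2r (size s)).
  by rewrite addSn -addnS -cardE card_last_path.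
apply: climb_trans (IH _ sF' Qs _); last by rewrite cardE cardQ addnS.
have [x [QE|PE]] := sdist_eq1 _ _ PQ.
  by move: QF; rewrite QE; apply: climb_step; exact: climb_refl.
have := fsubset_leq_card (fsubsetUr [fset x] Q).
by rewrite -PE cardQ ltnn.
Qed.

Lemma tight_path_climb F P Q s : P `<=` Q -> tight_path F P Q s -> climb F P Q.
Proof.
move=> PQ [sF lastQ szs es]; rewrite -lastQ; apply: path_climb => //.
by rewrite lastQ szs sdist_sub // cardfsDS // subnKC // fsubset_leq_card.
Qed.

Lemma family_spanP B P : P \in family_span B ->
  exists2 H : {fset {fset T}}, H `<=` B /\ H != fset0 & P = fcover H.
Proof.
rewrite /family_span => /imfsetP[H] /=; rewrite !inE fpowersetE.
by move=> /andP[HB H0] ->; exists H.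
Qed.

(** Common target of both criteria: each hypothesis on tight paths is converted into these climbs
    between base sets. *)
Lemma well_graded_climb F B : union_closed F -> is_base F B ->
  (forall K L, K \in B -> L \in B -> climb F K (L `|` K)) -> well_graded F.
Proof.
move=> UF [BF spanB _] KL.
(* Some base set [K] lies inside [P]; taking the union of the climb from [K] to [L]|[K] with [P]
   makes it start at [P]. *)
have PL P L : P \in F -> L \in B -> climb F P (L `|` P).
  move=> PF LB; have /family_spanP[H [HB H0] PE] : P \in family_span B.
    by rewrite spanB.
  have /fset0Pn[K KH] := H0.
  have KP : K `<=` P by rewrite PE; exact: bigfcup_sup.
  have := climbU _ _ _ _ UF PF (KL K L (fsubsetP HB _ KH) LB).
  by rewrite -fsetUA (fsetUidPr _ _ KP).
(* [Q] is a union of base sets, which are adjoined to [P] one at a time by [PL]. *)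
have PQ P Q : P \in F -> Q \in F -> climb F P (Q `|` P).
  move=> PF; rewrite -{1}spanB => /family_spanP[H [HB _] ->].
  rewrite /fcover; have : {subset enum_fset H <= B} by exact/fsubsetP.
  elim: (enum_fset H) => [|L s IH] sB.
    by rewrite big_nil fset0U; exact: climb_refl.
  have Ps := IH (fun A As => sB A (mem_behead (s := L :: s) As)).
  rewrite big_cons -fsetUA; apply: climb_trans (Ps) _; apply: PL.
    by have [] := climb_in _ _ _ Ps.
  exact/sB/mem_head.
(* The descent reverses the climb from [Q] to [P]|[Q]; the ascent is the climb from [P] to the same
   set. *)
move=> P Q PF QF _; apply: tight_path_down (PQ _ _ QF PF) (fsubset_refl _) _.
by rewrite fsetUC; apply/tight_path_up/PQ.
Qed.

Lemma well_graded_tight_path F P Q : well_graded F -> P \in F -> Q \in F ->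
  exists s, tight_path F P Q s.
Proof.
move=> WF PF QF; have [<-|] := eqVneq P Q; last exact: WF.
by exists [::]; exact: tight_path_refl.
Qed.

End Climb.

Theorem theorem7 (T : choiceType) (F B : {fset {fset T}})
    (F_union_closed : union_closed F) (B_base : is_base F B) :
  (well_graded F <->
     forall K L : {fset T}, K \in B -> L \in B -> K != L ->
       exists s : seq {fset T}, tight_path F K (L `|` K) s) /\
  (fset0 \in B ->
     (well_graded F <->
        forall K : {fset T}, K \in B ->
          exists s : seq {fset T}, tight_path F fset0 K s)).
Proof.
have [/fsubsetP BF _ _] := B_base.
split=> [|B0]; split=> [WF|tight].
- move=> K L KB LB _; apply: well_graded_tight_path => //; first exact: BF.
  by apply: union_closedU => //; exact: BF.
- apply: (well_graded_climb _ _ F_union_closed B_base) => K L KB LB.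
  have [<-|KL] := eqVneq K L; first by rewrite fsetUid; apply/climb_refl/BF.
  have [s] := tight K L KB LB KL; exact/tight_path_climb/fsubsetUr.
- by move=> K KB; apply: well_graded_tight_path => //; exact: BF.
- apply: (well_graded_climb _ _ F_union_closed B_base) => K L KB LB.
  (* The climb from the empty set to [L], united with [K], becomes a climb from [K] to [L]|[K]. *)
  have [s /(tight_path_climb _ _ _ _ (fsub0set _))] := tight L LB.
  by move/(climbU _ _ _ _ F_union_closed (BF K KB)); rewrite fset0U.
Qed.
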